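(* Let $(x_n)_{n\ge1}$ be a sequence in $\mathbb{R}^d$ with $\sup_n\frac1n\sum_{i=1}^n\|x_i\|^2<\infty$, and for each $n$ let $\hat{\mathcal J}(x_1,\ldots,x_n)$ be a MAP partition of $[n]$. Then for every $r>0$ $$\liminf_{n\to\infty}\frac{\min\{|J| : J\in\hat{\mathcal J}(x_1,\ldots,x_n),\ \exists\, j\in J\ \|x_j\|<r\}}{n}>0 .$$
   Context: Fix $d\ge 1$, $\alpha>0$ and symmetric positive definite matrices $T,\Sigma\in\mathbb{R}^{d\times d}$. Put $C=\alpha/\sqrt{\det T}$, $R=\Sigma^{-1/2}$ and $R_m=(\Sigma^{-1}+T^{-1}/m)^{1/2}$ for $m\in\mathbb{N}$ (symmetric positive definite square roots); $\|\cdot\|$ is the Euclidean norm and $[n]=\{1,\ldots,n\}$. For $\mathbf{x}=(x_1,\ldots,x_n)\in(\mathbb{R}^d)^n$, nonempty $J\subseteq[n]$, let $\overline{\mathbf{x}_J}=\frac1{|J|}\sum_{j\in J}x_j$. For a partition $\mathcal J$ of $[n]$ into nonempty sets (clusters) let $$Q_{\mathbf{x}}(\mathcal J)=C^{|\mathcal J|}\prod_{J\in\mathcal J}\frac{|J|!}{|J|^{(d+2)/2}\det R_{|J|}}\cdot\exp\Big\{\frac12\sum_{J\in\mathcal J}|J|\cdot\big\|R_{|J|}^{-1}R^2\,\overline{\mathbf{x}_J}\big\|^2\Big\}.$$ Up to a factor not depending on $\mathcal J$, this is the posterior probability of $\mathcal J$ given $\mathbf{x}$ in the Gaussian mixture model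 in which $\mathcal J$ follows the Chinese Restaurant Process with parameter $\alpha$, cluster means are i.i.d. $\mathcal N(0,T)$, and given its cluster mean $\theta$ each observation of a cluster is independently $\mathcal N(\theta,\Sigma)$. A MAP (maximal a posteriori) partition $\hat{\mathcal J}(x_1,\ldots,x_n)$ is any partition of $[n]$ maximising $Q_{\mathbf{x}}$. Convention: $\min\emptyset=+\infty$. *)

(* Defs.v *)
From mathcomp Require Import all_boot all_order all_algebra.
From mathcomp Require Import all_classical all_reals all_analysis.

Set Implicit Arguments.
Unset Strict Implicit.
Unset Printing Implicit Defensive.

Import Order.TTheory GRing.Theory Num.Theory.
Local Open Scope ring_scope.

(* The norm that the library puts on matrices is the sup norm, hence: *)
Definition enorm (R : realType) (d : nat) (v : 'cV[R]_d) : R :=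
  Num.sqrt (\sum_(i < d) v i 0 ^+ 2).

Definition spd (R : realType) (d : nat) (A : 'M[R]_d) : Prop :=
  A^T = A /\ forall v : 'cV[R]_d, v != 0 -> 0 < (v^T *m A *m v) 0 0.

(* The symmetric positive definite square root; a symmetric positive definite
   [A] has exactly one, and the default value [0] is only used for other [A]. *)
Definition spd_sqrt (R : realType) (d : nat) (A : 'M[R]_d) : 'M[R]_d :=
  xget 0 [set B : 'M[R]_d | spd B /\ B *m B = A]%classic.

Section Model.
Variables (R : realType) (d : nat) (alpha : R) (T Sigma : 'M[R]_d).

Definition crp_const : R := alpha / Num.sqrt (\det T).

Definition Rinf : 'M[R]_d := spd_sqrt (invmx Sigma).

Definition Rsize (m : nat) : 'M[R]_d :=
  spd_sqrt (invmx Sigma + m%:R^-1 *: invmx T).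

Section Observations.
Variables (n : nat) (x : 'I_n -> 'cV[R]_d).

Definition cluster_mean (J : {set 'I_n}) : 'cV[R]_d :=
  #|J|%:R^-1 *: \sum_(j in J) x j.

Definition posterior_score (P : {set {set 'I_n}}) : R :=
  crp_const ^+ #|P|
  * (\prod_(J in P)
       ((#|J|)`!%:R / (#|J|%:R `^ ((d%:R + 2) / 2) * \det (Rsize #|J|))))
  * expR (2^-1 * \sum_(J in P) #|J|%:R
      * enorm (invmx (Rsize #|J|) *m (Rinf *m Rinf) *m cluster_mean J) ^+ 2).

Definition MAP_partition (P : {set {set 'I_n}}) : Prop :=
  finset.partition P [set: 'I_n]%SET /\
  forall P' : {set {set 'I_n}}, finset.partition P' [set: 'I_n]%SET ->
    posterior_score P' <= posterior_score P.

End Observations.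
End Model.

(* Least size of a cluster of [P] meeting the open ball of radius [r] around
   the origin, [+oo] if there is none. *)
Definition min_cluster_near0 (R : realType) (d n : nat) (x : 'I_n -> 'cV[R]_d)
    (P : {set {set 'I_n}}) (r : R) : \bar R :=
  \big[Order.min/+oo%E]_(J in P | [exists j in J, enorm (x j) < r])
    (#|J|%:R)%:E.

(* Main.v *)
Require Import Defs.
From mathcomp Require Import all_boot all_order all_algebra.
From mathcomp Require Import all_classical all_reals all_analysis.
From mathcomp Require Import complex ring lra.
Import Order.TTheory GRing.Theory Num.Theory numFieldNormedType.Exports.
Local Open Scope ring_scope.
Set Implicit Arguments.
Unset Strict Implicit.

(** The score of a partition is a product of cluster scores
    [w |J| * exp (fit J / 2)].  Two comparisons of the MAP partition with a
    competitor give the result.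

    The weight [w m] behaves like [m!]: it lies within geometric factors of
    [m!], and [w (m+1) / w m] is of order [m + 1] ([size_weight_bounds]).  This
    needs the determinants of the matrices [R_m] to stay between two positive
    constants, which holds because [det (Sigma^-1 + t T^-1)] is a polynomial in
    [t] without zeros on the compact interval [[0, 1]].

    The quantity [fit J] is the maximum over [th] of a penalized log-likelihood
    ([penalized_loglik]), the maximum being attained at the posterior mean of
    the cluster.  Testing one cluster's optimal [th] on another cluster shows
    that the fit of a cluster is at most the sum of the squared
    [Sigma^-1]-norms of its points, and how much the fit changes when a single
    point enters or leaves.

    First comparison, with the one-cluster partition ([large_cluster]).  If
    every cluster had at most [eps * n] points, then the score would be at most
    [(const * eps * n) ^ n], because the fits add up to [O(n)] by the bound on
    the mean square and [|J|! <= (eps * n) ^ |J|].  The one-cluster partition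
    scores at least [n! / const ^ n >= (n / const') ^ n], which is larger once
    [eps] is small.  Hence some cluster [K] has at least [eps * n] points, and
    then its posterior mean is bounded, since the mean square over [K] is at
    most [1 / eps] times the mean square over all the points.

    Second comparison, with the partition where a point [x_j] of a cluster [J]
    is moved into [K] ([transfer_bound]).  The move multiplies the score by at
    least [const * |K| / |J|], up to the exponential of minus a quantity of the
    order of the squared norms of [x_j] and of the posterior mean of [K].  At a
    maximum this factor is at most [1], so that [|J| >= const * |K|] as soon as
    [x_j] lies in a fixed ball.  With [|K| >= eps * n] this is a linear lower
    bound on [|J|], valid for every [n >= 1] ([linear_cluster_size]). *)

(** * Symmetric positive definite matrices and their square roots *)

Lemma interpolation (F : fieldType) (s : seq F) (f : F -> F) :
  exists p : {poly F}, {in s, forall a, p.[a] = f a}.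
Proof.
elim: s => [|a s [p IHp]]; first by exists 0.
case: (boolP (a \in s)) => sa.
  by exists p => b; rewrite inE => /orP[/eqP->|]; exact: IHp.
pose w := \prod_(b <- s) ('X - b%:P).
have wa : w.[a] != 0 by move: sa; rewrite -root_prod_XsubC.
exists (p + ((f a - p.[a]) / w.[a]) *: w) => b.
rewrite inE hornerD hornerZ => /orP[/eqP->|sb].
  by rewrite divfK// addrC subrK.
have /rootP wb : root w b by rewrite root_prod_XsubC.
by rewrite IHp// wb mulr0 addr0.
Qed.

Section SPD.
Variables (R : realType).
Implicit Type d : nat.

Lemma trmx_mul_self_ge0 d (u : 'cV[R]_d) : 0 <= (u^T *m u) 0 0.
Proof. by rewrite mxE sumr_ge0// => i _; rewrite !mxE -expr2 sqr_ge0. Qed.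

Lemma trmx_mul_self_gt0 d (u : 'cV[R]_d) : u != 0 -> 0 < (u^T *m u) 0 0.
Proof.
move=> u0; rewrite lt_def trmx_mul_self_ge0 andbT; apply: contra u0.
rewrite mxE psumr_eq0 => [/allP u0|i _]; last by rewrite !mxE -expr2 sqr_ge0.
apply/eqP/matrixP => i j; rewrite ord1 mxE.
by have := u0 i (mem_index_enum _); rewrite !mxE -expr2 sqrf_eq0 => /eqP.
Qed.

Lemma spd_ge0 d (A : 'M[R]_d) (v : 'cV[R]_d) : spd A -> 0 <= (v^T *m A *m v) 0 0.
Proof.
by case=> _ pA; case: (eqVneq v 0) => [->|/pA/ltW//]; rewrite mulmx0 mxE.
Qed.

Lemma spd_unit d (A : 'M[R]_d) : spd A -> A \in unitmx.
Proof.
case=> sA pA; rewrite -row_free_unit -kermx_eq0; apply/negPn/negP => /rowV0Pn[v].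
move=> /sub_kermxP vA v0; have := pA v^T.
by rewrite trmx_eq0 trmxK vA mul0mx mxE ltxx => /(_ v0).
Qed.

Lemma spd_invmx d (A : 'M[R]_d) : spd A -> spd (invmx A).
Proof.
move=> spdA; have uA := spd_unit spdA; case: (spdA) => sA pA.
split; first by rewrite trmx_inv sA.
move=> v v0; have := pA (invmx A *m v); rewrite trmx_mul trmx_inv sA.
rewrite mulmxKV// mulmxA; apply.
by apply: contra v0 => /eqP /(congr1 (mulmx A)); rewrite mulKVmx// mulmx0 => ->.
Qed.

Lemma spdDZ d (A B : 'M[R]_d) t : 0 <= t -> spd A -> spd B -> spd (A + t *: B).
Proof.
move=> t0 [sA pA] spdB; case: (spdB) => sB pB; split.
  by rewrite linearD linearZ/= sA sB.
move=> v v0; rewrite mulmxDr mulmxDl mxE ltr_pwDl ?pA//.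
by rewrite -scalemxAr -scalemxAl mxE mulr_ge0// spd_ge0.
Qed.

Lemma trmx_horner_mx d (A : 'M[R]_d.+1) (p : {poly R}) :
  A^T = A -> (horner_mx A p)^T = horner_mx A p.
Proof.
move=> sA; elim/poly_ind: p => [|p c IH]; first by rewrite rmorph0 trmx0.
rewrite rmorphD rmorphM/= horner_mx_X horner_mx_C linearD/= tr_scalar_mx.
by rewrite trmx_mul IH sA (comm_mx_horner _ (erefl (A *m A))).
Qed.

Lemma spd_eigenvalue_gt0 d (A : 'M[R]_d) a : spd A -> eigenvalue A a -> 0 < a.
Proof.
move=> [_ pA] /eigenvalueP[v vA v0]; have vT0 : v^T != 0 by rewrite trmx_eq0.
have := pA _ vT0; rewrite trmxK vA -scalemxAl mxE.
have := trmx_mul_self_gt0 vT0; rewrite trmxK => v2.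
by rewrite pmulr_lgt0.
Qed.

(** A complex unitary diagonalization of [A] has real diagonal entries, which
    are eigenvalues of [A] and therefore positive.  A polynomial vanishing at
    them vanishes at [A], and this conclusion is again a statement about real
    matrices only: it is the form in which the spectral theorem can be used
    without leaving the real field. *)
Lemma spd_annihilator d (A : 'M[R]_d.+1) : spd A ->
  exists2 s : seq R, {in s, forall a, 0 < a} &
    forall p : {poly R}, {in s, forall a, root p a} -> horner_mx A p = 0.
Proof.
move=> spdA; pose f := real_complex R; pose A' := map_mx f A.
have hA : A' \is hermsymmx.
  apply: realsym_hermsym.
    apply/is_hermitianmxP; rewrite expr0 scale1r map_mx_id//.
    by rewrite /A' -[in LHS]spdA.1 map_trmx.
  by apply/mxOverP => i j; rewrite mxE; apply/complex_realP; exists (A i j).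
have eA := orthomx_spectralP (hermitian_normalmx hA).
have uP := spectral_unit A'.
have rsp := hermitian_spectral_diag_real hA.
move: (spectralmx A') (spectral_diag A') eA uP rsp => V D eA uV rD.
pose lam i := complex.Re (D 0 i).
have DE i : D 0 i = f (lam i) by rewrite -(RRe_real (mxOverP rD 0 i)).
exists [seq lam i | i : 'I_d.+1].
  move=> _ /mapP[i _ ->]; apply: spd_eigenvalue_gt0 spdA _.
  rewrite eigenvalue_root_char -(fmorph_root f) map_char_poly -/A'.
  rewrite -eigenvalue_root_char -[X in eigenvalue _ X]DE.
  apply/eigenvalueP; exists (row i V).
    rewrite [in LHS]eA -row_mul !mulmxA mulmxV// mul1mx row_mul.
    by rewrite row_diag_mx -scalemxAl -rowE.
  apply/eqP => Vi0; have := congr1 (mulmx^~ (invmx V)) Vi0.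
  rewrite -row_mul mulmxV// mul0mx => /matrixP/(_ 0 i).
  by rewrite !mxE eqxx => /eqP; rewrite oner_eq0.
move=> p rp; apply: (map_mx_inj (f := f)).
rewrite map_mx0 map_horner_mx -/A' eA horner_mx_uconjC// horner_mx_diag.
suff -> : map_mx (horner (map_poly f p)) D = 0 by rewrite linear0 mulmx0 mul0mx.
apply/matrixP => i j; rewrite ord1 !mxE DE; apply/rootP.
by rewrite fmorph_root rp// map_f// mem_enum.
Qed.

(** If a polynomial [q] takes the value [a^(1/4)] at each eigenvalue [a], then
    [q(A)^4 = A], so [q(A)^2] is a square root of [A].  Fourth roots are used
    because they make positivity immediate: [q(A)^2] is the square of a
    symmetric invertible matrix. *)
Lemma spd_sqrt_exists d (A : 'M[R]_d) : spd A ->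
  exists2 B : 'M[R]_d, spd B & B *m B = A.
Proof.
case: d A => [|d] A spdA; first by exists A => //; rewrite [LHS]flatmx0 [RHS]flatmx0.
have [s s_gt0 annA] := spd_annihilator spdA.
have [q qE] := interpolation s (fun a => Num.sqrt (Num.sqrt a)).
have q4 : horner_mx A q ^+ 4 = A.
  apply/eqP; rewrite -subr_eq0 -{2}(horner_mx_X A) -rmorphXn -rmorphB/=.
  apply/eqP/annA => a sa; rewrite rootE !hornerE qE//=.
  by rewrite (exprM _ 2 2) !sqr_sqrtr ?sqrtr_ge0 ?ltW ?s_gt0// subrr.
set Q := horner_mx A q in q4.
have sQ : Q^T = Q by rewrite /Q trmx_horner_mx//; case: spdA.
exists (Q *m Q); last by rewrite -q4 !exprS expr0 mulr1 -!mulmxE !mulmxA.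
split; first by rewrite trmx_mul sQ.
move=> v v0; rewrite mulmxA -mulmxA -{1}sQ -trmx_mul; apply: trmx_mul_self_gt0.
apply: contraNneq v0 => Qv0; have uA := spd_unit spdA.
by rewrite -[v](mulKmx uA) -{2}q4 !exprS expr0 mulr1 -!mulmxE -!mulmxA Qv0 !mulmx0.
Qed.

Lemma spd_sqrtP d (A : 'M[R]_d) : spd A ->
  spd (spd_sqrt A) /\ spd_sqrt A *m spd_sqrt A = A.
Proof.
move=> /spd_sqrt_exists[B spdB B2]; rewrite /spd_sqrt.
by case: xgetP => [C _ //|/(_ B)[]].
Qed.

(** The determinant is the square of that of the square root. *)
Lemma spd_det_gt0 d (A : 'M[R]_d) : spd A -> 0 < \det A.
Proof.
move=> spdA; have [_ B2] := spd_sqrtP spdA.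
have := spd_unit spdA; rewrite unitmxE unitfE -B2 det_mulmx -expr2 sqrf_eq0.
by move=> ?; rewrite exprn_even_gt0.
Qed.
End SPD.

(** * Quadratic forms *)

Section Forms.
Variables (R : realType) (d : nat).
Implicit Types (A : 'M[R]_d) (u v w : 'cV[R]_d).

Definition mxform A u v : R := (u^T *m A *m v) 0 0.

Lemma mxformDr A u v w : mxform A u (v + w) = mxform A u v + mxform A u w.
Proof. by rewrite /mxform mulmxDr mxE. Qed.

Lemma mxformZr A u a v : mxform A u (a *: v) = a * mxform A u v.
Proof. by rewrite /mxform -scalemxAr mxE. Qed.

Lemma mxformC A u v : A^T = A -> mxform A u v = mxform A v u.
Proof.
move=> sA; rewrite /mxform -[in LHS]trace_mx11 -mxtrace_tr !trmx_mul trmxK sA.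
by rewrite trace_mx11 mulmxA.
Qed.

Lemma mxform_sumr A u (I : finType) (J : {set I}) (f : I -> 'cV[R]_d) :
  mxform A u (\sum_(j in J) f j) = \sum_(j in J) mxform A u (f j).
Proof. by rewrite /mxform mulmx_sumr summxE. Qed.

Lemma mxform_addmx A B u v : mxform (A + B) u v = mxform A u v + mxform B u v.
Proof. by rewrite /mxform mulmxDr mulmxDl mxE. Qed.

Lemma mxform_scalemx a A u v : mxform (a *: A) u v = a * mxform A u v.
Proof. by rewrite /mxform -scalemxAr -scalemxAl mxE. Qed.

(** Positivity of the form at [u - v]. *)
Lemma mxform_cross_le A u v : spd A ->
  2 * mxform A u v <= mxform A u u + mxform A v v.
Proof.
move=> spdA; have := spd_ge0 (u + (-1) *: v) spdA; rewrite -/(mxform _ _ _).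
rewrite mxformDr mxformZr !(mxformC (_ + _)) ?spdA.1// !mxformDr !mxformZr.
rewrite (mxformC v u) ?spdA.1//; lra.
Qed.

Lemma mxform_norm_bound A : exists2 c : R, 0 <= c &
  forall u, mxform A u u <= c * enorm u ^+ 2.
Proof.
exists (\sum_i \sum_j `|A i j|); first by do 2!rewrite sumr_ge0// => ? _.
move=> u; rewrite /enorm sqr_sqrtr ?sumr_ge0// => [|i _]; last exact: sqr_ge0.
set s := (X in _ <= _ * X); rewrite /mxform -mulmxA mxE mulr_suml ler_sum// => i _.
rewrite !mxE mulr_sumr mulr_suml ler_sum// => j _.
have le_s k : u k 0 ^+ 2 <= s.
  rewrite /s (bigD1 k)//= lerDl sumr_ge0// => ? _; exact: sqr_ge0.
rewrite mulrCA (le_trans (ler_norm _))// normrM ler_wpM2l//.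
rewrite normrM; have := le_s i; have := le_s j.
rewrite -(real_normK (num_real (u i 0))) -(real_normK (num_real (u j 0))).
nra.
Qed.

Lemma complete_square A u v : spd A ->
  2 * mxform 1%:M u v - mxform A u u =
  mxform (invmx A) v v - mxform A (u - invmx A *m v) (u - invmx A *m v).
Proof.
move=> spdA; have uA := spd_unit spdA; set w := invmx A *m v.
have vE : v = A *m w by rewrite /w mulKVmx.
have -> : mxform 1%:M u v = mxform A u w.
  by rewrite /mxform mulmx1 vE mulmxA.
have -> : mxform (invmx A) v v = mxform A w w.
  by rewrite /mxform -mulmxA -/w vE trmx_mul spdA.1.
rewrite -[- w]scaleN1r mxformDr mxformZr.
rewrite !(mxformC (_ + _)) ?spdA.1// !mxformDr !mxformZr.
rewrite (mxformC w u) ?spdA.1//; ring.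
Qed.
End Forms.

(** * Determinants of the matrices R_m *)

Section Dets.
Variables (R : realType) (d : nat) (T Sigma : 'M[R]_d).
Hypotheses (hT : spd T) (hS : spd Sigma).

(** The determinant is a polynomial in [t], positive on the compact segment. *)
Lemma det_segment_bounds (A B : 'M[R]_d) : spd A -> spd B ->
  exists lo hi : R, 0 < lo /\
    forall t, 0 <= t <= 1 -> lo <= \det (A + t *: B) <= hi.
Proof.
move=> spdA spdB.
pose p := \det (map_mx polyC A + 'X *: map_mx polyC B).
have pE t : p.[t] = \det (A + t *: B).
  rewrite /p -/(horner_eval t _) -det_map_mx; congr (\det _).
  by apply/matrixP => i j; rewrite !mxE /= /horner_eval !hornerE.
have cp (A' : set R) : {within A', continuous (fun t : R => p.[t])}%classic.
  by apply: continuous_subspaceT => t; exact: continuous_horner.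
have [a a01 pa] := @EVT_min R (fun t => p.[t]) 0 1 ler01 (cp _).
have [b b01 pb] := @EVT_max R (fun t => p.[t]) 0 1 ler01 (cp _).
exists p.[a], p.[b]; split.
  by rewrite pE; apply/spd_det_gt0/spdDZ => //; case/andP: a01.
by move=> t t01; rewrite -pE pa//= pb.
Qed.

Lemma spd_Rsize m : spd (Rsize T Sigma m) /\
  Rsize T Sigma m *m Rsize T Sigma m = invmx Sigma + m%:R^-1 *: invmx T.
Proof. by apply/spd_sqrtP/spdDZ; rewrite ?invr_ge0//; exact: spd_invmx. Qed.

Lemma det_Rsize_bounds : exists lo hi : R, 0 < lo /\
  forall m, lo <= \det (Rsize T Sigma m) <= hi.
Proof.
have [lo [hi [lo0 b]]] := det_segment_bounds (spd_invmx hS) (spd_invmx hT).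
exists (Num.sqrt lo), (Num.sqrt hi); split=> [|m]; first by rewrite sqrtr_gt0.
have [/spd_det_gt0/ltW d0 R2] := spd_Rsize m.
have /b : 0 <= (m%:R^-1 : R) <= 1.
  by rewrite invr_ge0 ler0n/=; case: m {d0 R2} => [|m];
     rewrite ?invr0 ?ler01// invf_le1 ?ler1n ?ltr0n.
rewrite -R2 det_mulmx -expr2 -[X in _ -> _ <= X <= _](ger0_norm d0) -sqrtr_sqr.
by case/andP => ? ?; rewrite !ler_wsqrtr.
Qed.
End Dets.

(** * Variational description of the fit of a cluster *)

Section Fit.
Variables (R : realType) (d : nat) (T Sigma : 'M[R]_d).
Hypotheses (hT : spd T) (hS : spd Sigma).
Variables (n : nat) (x : 'I_n -> 'cV[R]_d).
Implicit Types (J K : {set 'I_n}) (th : 'cV[R]_d).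

Let P := invmx Sigma.
Let W := invmx T.
Let spdP : spd P := spd_invmx hS.
Let spdW : spd W := spd_invmx hT.

(** Twice the exponent contributed by a cluster to the posterior score. *)
Definition fit J : R := #|J|%:R
  * enorm (invmx (Rsize T Sigma #|J|) *m (Rinf Sigma *m Rinf Sigma)
           *m cluster_mean x J) ^+ 2.

(** Twice the logarithm of the joint density of the points of [J] and of a
    cluster mean [th], without the terms that do not involve [th]. *)
Definition penalized_loglik J th : R :=
  \sum_(j in J) (2 * mxform P th (x j) - mxform P th th) - mxform W th th.

(** The mean of the conditional law of the cluster mean given the points of
    the cluster; this is where [penalized_loglik J] is maximal. *)
Definition posterior_mean J : 'cV[R]_d :=
  invmx (P + #|J|%:R^-1 *: W) *m (P *m cluster_mean x J).

(** Both sides are quadratic in [th] with leading part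
    [- |J| * (Sigma^-1 + T^-1 / |J|)], and [R_|J|] is a square root of the
    matrix in parentheses: completing the square makes [fit J] appear as the
    constant term. *)
Lemma fit_complete_square J th : (0 < #|J|)%N ->
  penalized_loglik J th = fit J - #|J|%:R *
    mxform (P + #|J|%:R^-1 *: W) (th - posterior_mean J) (th - posterior_mean J).
Proof.
move=> J0; have m0 : #|J|%:R != 0 :> R by rewrite pnatr_eq0 -lt0n.
have [spdB BB] := spd_Rsize hT hS #|J|; have [_ RR] := spd_sqrtP spdP.
have spdA : spd (P + #|J|%:R^-1 *: W) by apply: spdDZ; rewrite ?invr_ge0.
have fitE : fit J = #|J|%:R *
    mxform (invmx (P + #|J|%:R^-1 *: W)) (P *m cluster_mean x J)
      (P *m cluster_mean x J).
  rewrite /fit [Rinf Sigma *m _]RR -mulmxA; move: (P *m _) => v.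
  set B := Rsize _ _ _ in spdB BB *.
  congr (_ * _); rewrite /enorm sqr_sqrtr ?sumr_ge0// => [|i _]; last exact: sqr_ge0.
  have uB := spd_unit spdB.
  have -> : invmx (P + #|J|%:R^-1 *: W) = invmx B *m invmx B.
    have uBB : B *m B \in unitmx by rewrite unitmx_mul uB.
    by rewrite -BB -[RHS](mulmxK uBB) mulmxA mulmxKV// mulVmx// mul1mx.
  rewrite /mxform !mulmxA -mulmxA.
  rewrite -[X in v^T *m X](spd_invmx spdB).1 -trmx_mul mxE.
  by apply: eq_bigr => i _; rewrite [in RHS]mxE expr2.
have -> : penalized_loglik J th = #|J|%:R * (2 * mxform 1%:M th (P *m cluster_mean x J)
    - mxform (P + #|J|%:R^-1 *: W) th th).
  have -> : mxform 1%:M th (P *m cluster_mean x J) = mxform P th (cluster_mean x J).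
    by rewrite /mxform mulmx1 mulmxA.
  rewrite /penalized_loglik sumrB -mulr_sumr sumr_const -mulr_natl.
  rewrite mxform_addmx mxform_scalemx /cluster_mean mxformZr mxform_sumr.
  by field.
by rewrite complete_square// mulrBr -fitE.
Qed.

Lemma penalized_loglik_le_fit J th : penalized_loglik J th <= fit J.
Proof.
have [/cards0_eq->|J0] := posnP #|J|.
  rewrite /penalized_loglik big_set0 /fit cards0 mul0r sub0r oppr_le0.
  exact: spd_ge0.
rewrite fit_complete_square// gerBl mulr_ge0//.
by apply/spd_ge0/spdDZ => //; rewrite invr_ge0.
Qed.

Lemma fit_posterior_mean J : (0 < #|J|)%N ->
  fit J = penalized_loglik J (posterior_mean J).
Proof.
by move=> J0; rewrite fit_complete_square// subrr /mxform mulmx0 mxE mulr0 subr0.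
Qed.

Lemma fit_ge0 J : 0 <= fit J.
Proof. by rewrite mulr_ge0// sqr_ge0. Qed.

(** Any [th] is an admissible test point for the larger cluster; it will be
    used with the posterior mean of [K]. *)
Lemma fit_setU1 K j th : j \notin K ->
  penalized_loglik K th + (2 * mxform P th (x j) - mxform P th th) <= fit (j |: K).
Proof.
move=> jK; apply: le_trans (penalized_loglik_le_fit _ th).
by rewrite /penalized_loglik big_setU1//=; lra.
Qed.

(** The maximizer for [J] is a test point for [J] without [j], and the term
    that it loses is at most the squared norm of [x j]. *)
Lemma fit_setD1 J j : j \in J -> fit J <= fit (J :\ j) + mxform P (x j) (x j).
Proof.
move=> jJ; have J0 : (0 < #|J|)%N by rewrite (cardD1 j) jJ.
rewrite fit_posterior_mean//; set th := posterior_mean J.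
have := penalized_loglik_le_fit (J :\ j) th.
rewrite /penalized_loglik (big_setD1 _ jJ)/=.
have := mxform_cross_le th (x j) spdP; lra.
Qed.

Lemma fit_le_sum J : fit J <= \sum_(j in J) mxform P (x j) (x j).
Proof.
have [/cards0_eq->|J0] := posnP #|J|; first by rewrite /fit cards0 mul0r big_set0.
rewrite fit_posterior_mean// /penalized_loglik lerBlDr ler_wpDr ?spd_ge0//.
by apply: ler_sum => j _; rewrite lerBlDl mxform_cross_le.
Qed.

(** At the posterior mean the penalized log-likelihood is nonnegative, being
    the fit.  The bound follows by splitting each cross term with the
    inequality [2 <th, x> <= |th|^2 / 2 + 2 |x|^2]. *)
Lemma posterior_mean_bound J : (0 < #|J|)%N ->
  #|J|%:R * mxform P (posterior_mean J) (posterior_mean J) <=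
  4 * \sum_(j in J) mxform P (x j) (x j).
Proof.
move=> J0; have := fit_ge0 J; rewrite fit_posterior_mean//.
set th := posterior_mean J; rewrite /penalized_loglik => fit0.
have : \sum_(j in J) (2 * mxform P th (x j) - mxform P th th) <=
       \sum_(j in J) (2 * mxform P (x j) (x j) - 2^-1 * mxform P th th).
  (* The cross inequality at [th / 2] and [x j], doubled. *)
  apply: ler_sum => j _; have := mxform_cross_le (2^-1 *: th) (x j) spdP.
  rewrite mxformZr (mxformC (_ *: _) (x j)) ?(mxformC (_ *: _) th) ?spdP.1// !mxformZr.
  rewrite (mxformC (x j)) ?spdP.1//; lra.
rewrite [X in _ <= X -> _]sumrB -mulr_sumr sumr_const -[X in _ - X]mulr_natl.
have : 0 <= mxform W th th by exact: spd_ge0.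
nra.
Qed.
End Fit.

(** * Growth of the weight of a cluster with its size *)

(** The two ways in which the growth of the weights enters: globally, the
    weights are factorials up to geometric factors; locally, one more point
    multiplies the weight by the new size, up to a constant. *)
Definition factorial_like (R : realType) (w : nat -> R) (c B : R) :=
  forall m : nat, (0 < m)%N ->
  [/\ 0 < w m,
      w m <= c * m`!%:R,
      m`!%:R <= c * B ^+ m * w m,
      m.+1%:R * w m <= c * w m.+1 &
      w m.+1 <= c * m.+1%:R * w m].

Section Weight.
Variables (R : realType) (d : nat) (alpha : R) (T Sigma : 'M[R]_d).
Hypotheses (halpha : 0 < alpha) (hT : spd T) (hS : spd Sigma).

Definition size_weight (m : nat) : R := crp_const alpha T
  * (m`!%:R / (m%:R `^ ((d%:R + 2) / 2) * \det (Rsize T Sigma m))).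

(** The power [m^((d+2)/2)] is at most [(2^((d+2)/2))^m] and changes by a factor
    at most [2^((d+2)/2)] from [m] to [m + 1]; the determinants stay between
    two positive constants. *)
Lemma size_weight_bounds :
  exists c B : R, [/\ 1 <= c, 1 <= B & factorial_like size_weight c B].
Proof.
have [lo [hi [lo0 bnd]]] := det_Rsize_bounds hT hS.
pose C := crp_const alpha T; pose a : R := (d%:R + 2) / 2; pose B : R := 2 `^ a.
have C0 : 0 < C by rewrite /C divr_gt0// sqrtr_gt0 spd_det_gt0.
have a0 : 0 <= a by rewrite divr_ge0// addr_ge0.
have B1 : 1 <= B by rewrite -[1](powRr0 2) ler_powR// ler1n.
have hi0 : 0 < hi by have /andP[l h] := bnd 0; exact: lt_le_trans (le_trans l h).
pose u m : R := m%:R `^ a * \det (Rsize T Sigma m).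
have wE m : size_weight m = C * (m`!%:R / u m) by [].
have powB m : (0 < m)%N -> 1 <= (m%:R : R) `^ a <= B ^+ m.
  move=> m0; rewrite -{1}(powRr0 m%:R) ler_powR ?ler1n//=.
  rewrite /B -powR_mulrn ?powR_ge0// -powRrM mulrC (powRrM 2) powR_mulrn//.
  by rewrite ge0_ler_powR ?nnegrE// -natrX ler_nat ltnW// ltn_expl.
have powS m : (0 < m)%N -> (m.+1%:R : R) `^ a <= B * m%:R `^ a.
  move=> m0; rewrite /B -powRM// ge0_ler_powR ?nnegrE ?mulr_ge0//.
  by rewrite -natrM ler_nat mul2n -addnn -addn1 leq_add2l.
have powS1 m : (m%:R : R) `^ a <= m.+1%:R `^ a.
  by rewrite ge0_ler_powR ?nnegrE// ler_nat.
have u_lo m : (0 < m)%N -> lo <= u m.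
  move=> m0; have /andP[l _] := bnd m; have /andP[p _] := powB m m0.
  by rewrite (le_trans l)// ler_peMl// (le_trans (ltW lo0)).
have u_hi m : (0 < m)%N -> u m <= hi * B ^+ m.
  move=> m0; have /andP[l h] := bnd m; have /andP[_ p] := powB m m0.
  by rewrite mulrC ler_pM// ?powR_ge0// (le_trans (ltW lo0)).
have uS m : (0 < m)%N -> lo * u m.+1 <= B * hi * u m.
  move=> m0; have /andP[l h] := bnd m; have /andP[l1 h1] := bnd m.+1.
  have dm0 := lt_le_trans lo0 l1.
  have -> : B * hi * u m = (B * m%:R `^ a) * (hi * \det (Rsize T Sigma m)).
    by rewrite /u; ring.
  have -> : lo * u m.+1 = m.+1%:R `^ a * (\det (Rsize T Sigma m.+1) * lo).
    by rewrite /u; ring.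
  by rewrite ler_pM ?powR_ge0 ?mulr_ge0 ?powS ?ler_pM ?(ltW dm0) ?(ltW lo0).
have uV m : lo * u m <= hi * u m.+1.
  have /andP[l h] := bnd m; have /andP[l1 h1] := bnd m.+1.
  have dm0 := lt_le_trans lo0 l.
  have -> : lo * u m = m%:R `^ a * (\det (Rsize T Sigma m) * lo).
    by rewrite /u; ring.
  have -> : hi * u m.+1 = m.+1%:R `^ a * (hi * \det (Rsize T Sigma m.+1)).
    by rewrite /u; ring.
  by rewrite ler_pM ?powR_ge0 ?mulr_ge0 ?ler_pM ?(ltW dm0) ?(ltW lo0).
have hl : 0 < hi / lo by rewrite divr_gt0.
(* A common constant for the four bounds: each of them needs one of the terms. *)
pose c := 1 + C / lo + hi / C + B * (hi / lo).
have [t1 t2] : 0 < C / lo /\ 0 < hi / C by split; exact: divr_gt0.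
have t3 : hi / lo <= B * (hi / lo) by rewrite ler_peMl// ltW.
have c1 : 1 <= c by rewrite /c; lra.
exists c, B; split=> //.
move=> m m0.
have um := lt_le_trans lo0 (u_lo m m0).
have um1 := lt_le_trans lo0 (u_lo m.+1 isT).
have f0 k : 0 < k`!%:R :> R by rewrite ltr0n fact_gt0.
have facS : m.+1`!%:R = m.+1%:R * m`!%:R :> R by rewrite factS natrM.
split.
- by rewrite wE mulr_gt0// divr_gt0.
- rewrite wE mulrA ler_pdivrMr//.
  have : C <= c * u m.
    apply: (@le_trans _ _ (C / lo * u m)).
      by rewrite -mulrA ler_peMr ?(ltW C0)// mulrC ler_pdivlMr// mul1r u_lo.
    by rewrite ler_wpM2r ?(ltW um)// /c; lra.
  by move=> h; rewrite [leRHS]mulrAC ler_pM2r.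
- rewrite wE.
  have : u m <= c * B ^+ m * C.
    rewrite (le_trans (u_hi m m0))// mulrAC ler_pM2r ?exprn_gt0 ?(lt_le_trans ltr01)//.
    by rewrite -ler_pdivrMr// /c; lra.
  have -> : c * B ^+ m * (C * (m`!%:R / u m)) = c * B ^+ m * C * m`!%:R / u m.
    by ring.
  by move=> h; rewrite ler_pdivlMr// mulrC ler_pM2r.
- rewrite !wE facS.
  have : u m.+1 <= c * u m.
    rewrite -(ler_pM2l lo0) (le_trans (uS m m0))// [leRHS]mulrA ler_pM2r//.
    rewrite -ler_pdivrMl//; have -> : lo^-1 * (B * hi) = B * (hi / lo) by ring.
    by rewrite /c; lra.
  move=> h.
  have -> : m.+1%:R * (C * (m`!%:R / u m)) = (m.+1%:R * C * m`!%:R) * (u m)^-1.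
    by ring.
  have -> : c * (C * (m.+1%:R * m`!%:R / u m.+1)) =
    (m.+1%:R * C * m`!%:R) * (c * (u m.+1)^-1) by ring.
  apply: ler_wpM2l; first by rewrite !mulr_ge0// ltW.
  by rewrite ler_pdivlMr// mulrC ler_pdivrMr.
- rewrite !wE facS.
  have : u m <= c * u m.+1.
    rewrite -(ler_pM2l lo0) (le_trans (uV m))// [leRHS]mulrA ler_pM2r//.
    by rewrite -ler_pdivrMl// mulrC /c; lra.
  move=> h; have -> : C * (m.+1%:R * m`!%:R / u m.+1) =
    (m.+1%:R * C * m`!%:R) * (u m.+1)^-1 by ring.
  have -> : c * m.+1%:R * (C * (m`!%:R / u m)) =
    (m.+1%:R * C * m`!%:R) * (c * (u m)^-1) by ring.
  apply: ler_wpM2l; first by rewrite !mulr_ge0// ltW.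
  by rewrite ler_pdivlMr// mulrC ler_pdivrMr.
Qed.
End Weight.

(** * Moving a point between two blocks of a partition *)

(** The product is taken with [F set0 = 1] so that the case where [j] was alone
    in its block, in which that block disappears, has the same formula. *)
Lemma partition_transfer (I : finType) (R : comPzRingType) (P : {set {set I}})
    (J K : {set I}) (j : I) (F : {set I} -> R) :
  finset.partition P [set: I]%SET -> J \in P -> K \in P -> J != K -> j \in J ->
  F finset.set0 = 1 ->
  exists2 P', finset.partition P' [set: I]%SET &
    \prod_(A in P') F A =
    F (J :\ j) * F (j |: K) * \prod_(A in P :\ J :\ K) F A.
Proof.
move=> partP PJ PK JK jJ F0; pose D := ([set: I] :\: J :\: K)%SET.
have PK' : K \in P :\ J by rewrite !inE eq_sym JK.
have partD := partitionD1 (partitionD1 partP PJ) PK'.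
have JnK i : i \in J -> i \notin K.
  have /finset.trivIsetP/(_ _ _ PJ PK JK) := partition_trivIset partP.
  by move=> /disjointFr dJK /dJK ->.
have Knew : [disjoint j |: K & D]%SET.
  rewrite disjoint_subset; apply/fintype.subsetP => i; rewrite !inE.
  by case/orP => [/eqP->|->]; rewrite ?jJ ?andbF.
have K0 : (j |: K)%SET != finset.set0.
  by apply/finset.set0Pn; exists j; rewrite !inE eqxx.
have partU := partitionU1 partD K0 Knew.
have notinD (A : {set I}) i : finset.partition (P :\ J :\ K) D -> i \in A ->
    i \notin D -> A \notin P :\ J :\ K.
  by move=> pD iA; apply: contraNN => /(partitionS pD)/fintype.subsetP; apply.
have nK : (j |: K)%SET \notin P :\ J :\ K.
  by apply: (notinD _ j partD); rewrite !inE ?eqxx// jJ andbF.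
have [J0|J0] := eqVneq (J :\ j) finset.set0.
  exists ((j |: K) |: (P :\ J :\ K))%SET; last by rewrite big_setU1//= J0 F0 mul1r.
  suff <- : ((j |: K) :|: D)%SET = [set: I]%SET by [].
  apply/finset.setP => i; rewrite !inE; have /finset.setP/(_ i) := J0; rewrite !inE.
  by case: (i == j); case: (i \in K); case: (i \in J).
exists ((J :\ j) |: ((j |: K) |: (P :\ J :\ K)))%SET.
  suff -> : [set: I]%SET = ((J :\ j) :|: ((j |: K) :|: D))%SET.
    apply: partitionU1 => //; rewrite disjoint_subset; apply/fintype.subsetP => i.
    rewrite !inE => /andP[ij iJ]; rewrite (negbTE ij) iJ andbF/= orbF.
    exact: JnK.
  apply/finset.setP => i; rewrite !inE.
  by case: (i == j); case: (i \in K); case: (i \in J).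
rewrite big_setU1/= ?big_setU1//= ?mulrA//.
have [i iJ] := finset.set0Pn _ J0; have /setD1P[ij iJ'] := iJ.
rewrite in_setU1 negb_or (notinD _ i partD iJ) ?inE ?iJ' ?andbF// andbT.
by apply: contraTneq iJ => ->; rewrite !inE negb_or ij JnK.
Qed.

(** * Comparing the MAP partition with its competitors *)

Lemma fact_le_exprn (R : realType) (a : R) m : m%:R <= a -> m`!%:R <= a ^+ m.
Proof.
elim: m => [|m IH] ma; first by rewrite expr0.
rewrite factS natrM exprS ler_pM// IH//; apply: le_trans ma.
by rewrite ler_nat.
Qed.

(** The term of index [m] of the exponential series at [m]. *)
Lemma exprn_le_expR_fact (R : realType) m : m%:R ^+ m <= expR 1 ^+ m * m`!%:R :> R.
Proof.
case: m => [|m]; first by rewrite !expr0 mul1r.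
rewrite -ler_pdivrMr ?ltr0n ?fact_gt0// -expRM_natl mulr1.
by rewrite (le_trans _ (expR_ge1Dxn m (ler0n R m.+1)))// lerDr.
Qed.

Lemma transfer_arith (R : realType) (c k m sJ sK sD sU e1 e2 : R) :
  0 < c -> 0 < sK -> 0 < sD -> k * sK * e1 <= c * sU ->
  sJ <= c * m * sD * e2 -> sD * sU <= sJ * sK -> k * e1 <= c ^+ 2 * m * e2.
Proof.
move=> c0 sK0 sD0 hU hD hM.
have {}hM : sU <= c * m * e2 * sK.
  rewrite -(ler_pM2l sD0) (le_trans hM)//.
  have -> : sD * (c * m * e2 * sK) = (c * m * sD * e2) * sK by ring.
  by rewrite ler_pM2r.
rewrite -(ler_pM2r sK0) mulrAC (le_trans hU)//.
have -> : c ^+ 2 * m * e2 * sK = c * (c * m * e2 * sK) by ring.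
by rewrite ler_pM2l.
Qed.

Section Scores.
Variables (R : realType) (d : nat) (alpha : R) (T Sigma : 'M[R]_d).
Hypotheses (hT : spd T) (hS : spd Sigma).
Variables (n : nat) (x : 'I_n -> 'cV[R]_d).
Implicit Types (J K : {set 'I_n}) (P : {set {set 'I_n}}).
Let w := size_weight alpha T Sigma.
Variables (c B : R).
Hypotheses (c1 : 1 <= c) (B1 : 1 <= B) (wE : factorial_like w c B).
Let q (u : 'cV[R]_d) := mxform (invmx Sigma) u u.
Let spdP : spd (invmx Sigma) := spd_invmx hS.

(** The value at the empty set is that of a factor which is absent. *)
Definition cluster_score J : R := if #|J| == 0 then 1 else
  size_weight alpha T Sigma #|J| * expR (2^-1 * fit T Sigma x J).

Lemma cluster_scoreE J : (0 < #|J|)%N ->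
  cluster_score J = w #|J| * expR (2^-1 * fit T Sigma x J).
Proof. by rewrite /cluster_score lt0n => /negbTE ->. Qed.

Lemma cluster_score_gt0 J : 0 < cluster_score J.
Proof.
have [J0|J0] := posnP #|J|; first by rewrite /cluster_score J0 eqxx.
by rewrite cluster_scoreE// mulr_gt0 ?expR_gt0//; case: (wE J0).
Qed.

Lemma posterior_score_prod P : finset.partition P [set: 'I_n]%SET ->
  posterior_score alpha T Sigma x P = \prod_(J in P) cluster_score J.
Proof.
move=> partP; rewrite /posterior_score mulr_sumr expR_sum -prodr_const.
rewrite -!big_split/=; apply: eq_bigr => J PJ; rewrite cluster_scoreE//.
by rewrite card_gt0 (partition_neq0 partP).
Qed.

Lemma cluster_score_setU1 K j (th := posterior_mean T Sigma x K) :
  (0 < #|K|)%N -> j \notin K ->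
  #|K|.+1%:R * cluster_score K
    * expR (2^-1 * (2 * mxform (invmx Sigma) th (x j) - q th)) <=
  c * cluster_score (j |: K).
Proof.
move=> K0 jK; have cK : #|(j |: K)%SET| = #|K|.+1 by rewrite cardsU1 jK.
have := fit_setU1 hT hS x th jK; rewrite -(fit_posterior_mean hT hS)//.
rewrite !cluster_scoreE ?cK//; move: (fit _ _ _ _) (fit _ _ _ _) => fU fK hfit.
rewrite mulrA -mulrA -expRD mulrA.
have [w0 _ _ h _] := wE K0.
apply: ler_pM; rewrite ?expR_ge0//; first exact: (mulr_ge0 _ (ltW w0)).
by rewrite ler_expR -mulrDr ler_wpM2l.
Qed.

Lemma cluster_score_setD1 J j : j \in J ->
  cluster_score J <=
  c * #|J|%:R * cluster_score (J :\ j) * expR (2^-1 * q (x j)).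
Proof.
move=> jJ; have cJ : #|J| = #|J :\ j|.+1 by rewrite (cardsD1 j) jJ.
have J0 : (0 < #|J|)%N by rewrite cJ.
have hfit := fit_setD1 hT hS x jJ.
have [e|D0] := posnP #|J :\ j|.
  have Jj := cards0_eq e; rewrite Jj in hfit.
  have -> : cluster_score (J :\ j) = 1 by rewrite /cluster_score e.
  rewrite cluster_scoreE// cJ e mulr1 mulr1 ler_pM ?expR_ge0//.
  - by case: (wE (ltn0Sn 0)) => /ltW.
  - by case: (wE (ltn0Sn 0)) => _ /le_trans-> //; rewrite mulr1.
  rewrite ler_expR; move: hfit; rewrite /fit cards0 mul0r add0r /q; lra.
rewrite !cluster_scoreE// cJ mulrA -mulrA -expRD.
have [_ _ _ _ h] := wE D0; have [/ltW w0 _ _ _ _] := wE J0.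
rewrite ler_pM ?expR_ge0// -?cJ// ?cJ// ler_expR -mulrDr ler_wpM2l//.
Qed.

(** The exponents lost and gained when a point [u] moves to a cluster with
    posterior mean [v] differ by half the squared norm of [u - v], which is at
    most the sum of the squared norms. *)
Lemma half_quad_le u v :
  2^-1 * q u <= q u + q v + 2^-1 * (2 * mxform (invmx Sigma) v u - q v).
Proof.
have := mxform_cross_le v (- u) spdP.
rewrite -[- u]scaleN1r !mxformZr (mxformC (-1 *: u) u) ?spdP.1// !mxformZr /q.
have := spd_ge0 u spdP; have := spd_ge0 v spdP; rewrite -!/(mxform _ _ _); lra.
Qed.

(** Moving [j] from [J] to [K] does not increase the score of a maximizer.  For
    [J = K] the bound is trivial. *)
Lemma transfer_bound P J K j :
  MAP_partition alpha T Sigma x P -> J \in P -> K \in P -> j \in J ->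
  #|K|%:R <= c ^+ 2 * #|J|%:R
    * expR (q (x j) + q (posterior_mean T Sigma x K)).
Proof.
move=> [partP maxP] PJ PK jJ; set th := posterior_mean T Sigma x K.
have q0 u : 0 <= q u by exact: spd_ge0.
have [<-|JK] := eqVneq J K.
  rewrite mulrAC ler_peMl// mulr_ege1 ?exprn_ege1//.
  by rewrite -expR0 ler_expR addr_ge0.
have K0 : (0 < #|K|)%N by rewrite card_gt0 (partition_neq0 partP).
have jK : j \notin K.
  have /finset.trivIsetP/(_ _ _ PJ PK JK) := partition_trivIset partP.
  by move=> /disjointFr dJK; rewrite dJK.
have s0 : cluster_score finset.set0 = 1 by rewrite /cluster_score cards0.
have [P' partP' P'E] := partition_transfer partP PJ PK JK jJ s0.
have := maxP P' partP'; rewrite !posterior_score_prod// P'E.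
have PK' : K \in P :\ J by rewrite !inE eq_sym JK.
rewrite (big_setD1 J PJ)/= (big_setD1 K PK')/= [leRHS]mulrA.
rewrite ler_pM2r; last by apply: prodr_gt0 => A _; exact: cluster_score_gt0.
move=> /(transfer_arith (lt_le_trans ltr01 c1) (cluster_score_gt0 K)
  (cluster_score_gt0 (J :\ j)) (cluster_score_setU1 K0 jK)
  (cluster_score_setD1 jJ)); set e1 := (X in _ * expR X) => hU.
apply: (@le_trans _ _ #|K|.+1%:R); first by rewrite ler_nat.
rewrite -(ler_pM2r (expR_gt0 e1)) (le_trans hU)// -[leRHS]mulrA.
apply: ler_wpM2l; first by rewrite mulr_ge0// exprn_ge0// (le_trans ler01).
by rewrite -expRD ler_expR half_quad_le.
Qed.

(** Otherwise the score would be smaller than that of the one-cluster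
    partition.  The value of [eps] makes the base of the [n]-th power that
    bounds the score from above, multiplied by the geometric factors of
    [n^n <= e^n n!] and [n! <= c B^n w n], equal to [n / 2]. *)
Lemma large_cluster P L : (0 < n)%N -> MAP_partition alpha T Sigma x P ->
  \sum_(i < n) q (x i) <= L * n%:R ->
  let eps := (2 * c ^+ 2 * B * expR 1 * expR (L / 2))^-1 in
  exists2 K, K \in P & eps * n%:R <= #|K|%:R.
Proof.
move=> n0 [partP maxP] hL eps; apply: contrapT => noK.
have small J : J \in P -> #|J|%:R <= eps * n%:R.
  by move=> PJ; rewrite leNgt; apply/negP => /ltW ?; apply: noK; exists J.
have c0 : 0 < c := lt_le_trans ltr01 c1.
have B0 : 0 < B := lt_le_trans ltr01 B1.
have n0R : 0 < n%:R :> R by rewrite ltr0n.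
have eps0 : 0 < eps by rewrite invr_gt0 !mulr_gt0 ?expR_gt0 ?exprn_gt0.
have arith (e a b : R) : e * (2 * c ^+ 2 * B * a * b) = 1 ->
    a * (c * B * (c * (e * n%:R) * b)) = n%:R / 2.
  move=> eE.
  have -> : a * (c * B * (c * (e * n%:R) * b)) =
    e * (2 * c ^+ 2 * B * a * b) * (n%:R / 2) by field.
  by rewrite eE mul1r.
(* The factor [c] of each cluster is charged to one of its points, as [1 <= c]. *)
have scoreP : posterior_score alpha T Sigma x P <=
    (c * (eps * n%:R) * expR (L / 2)) ^+ n.
  rewrite posterior_score_prod//.
  apply: (@le_trans _ _ (\prod_(J in P) \prod_(j in J)
    (c * (eps * n%:R) * expR (2^-1 * q (x j))))).
    apply: ler_prod => J PJ; rewrite ltW ?cluster_score_gt0//=.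
    have J0 : (0 < #|J|)%N by rewrite card_gt0 (partition_neq0 partP).
    rewrite cluster_scoreE// big_split/= prodr_const -expR_sum -mulr_sumr exprMn.
    have [/ltW w0 wle _ _ _] := wE J0.
    rewrite ler_pM ?expR_ge0//; last first.
      by rewrite ler_expR ler_wpM2l//; exact: fit_le_sum.
    rewrite (le_trans wle)// ler_pM ?(ltW c0) ?fact_le_exprn ?small//.
    by rewrite -[X in X <= _]expr1 ler_weXn2l.
  rewrite -(set_partition_big _ partP) big_split/= prodr_const cardsT card_ord.
  rewrite -expR_sum -mulr_sumr [leRHS]exprMn.
  apply: ler_wpM2l; first by rewrite exprn_ge0// !mulr_ge0// ltW.
  rewrite -expRM_natl ler_expR; under eq_bigl do rewrite finset.in_setT.
  by lra.
have partT : finset.partition [set [set: 'I_n]]%SET [set: 'I_n]%SET.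
  rewrite /finset.partition /finset.cover finset.big_set1 eqxx finset.trivIset1 /=.
  by rewrite !inE eq_sym -card_gt0 cardsT card_ord.
have cT : (0 < #|[set: 'I_n]%SET|)%N by rewrite cardsT card_ord.
have scoreT : w n <= posterior_score alpha T Sigma x P.
  apply: le_trans (maxP _ partT); rewrite posterior_score_prod// big_set1.
  rewrite cluster_scoreE// cardsT card_ord ler_peMr//; first by case: (wE n0) => /ltW.
  by rewrite -expR0 ler_expR mulr_ge0// fit_ge0.
have [w0 _ wn _ _] := wE n0.
(* The contradiction: the two score bounds combined. *)
have : n%:R ^+ n <= (n%:R / 2) ^+ n :> R.
  apply: (le_trans (exprn_le_expR_fact _ n)).
  apply: (@le_trans _ _ (expR 1 ^+ n * (c ^+ n * B ^+ n *
      (c * (eps * n%:R) * expR (L / 2)) ^+ n))).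
    rewrite ler_wpM2l ?exprn_ge0 ?expR_ge0// (le_trans wn)//.
    apply: ler_pM; last exact: le_trans scoreT scoreP.
    - by rewrite mulr_ge0 ?exprn_ge0 ?ltW.
    - exact: ltW.
    - by rewrite ler_wpM2r ?exprn_ge0 ?(ltW B0)// -[leLHS]expr1 ler_weXn2l.
  rewrite -!exprMn arith// mulVf// gt_eqF// !mulr_gt0 ?expR_gt0 ?exprn_gt0//.
apply/negP; rewrite -ltNge ltrXn2r ?nnegrE -?lt0n//; lra.
Qed.
End Scores.

(** * The lower limit *)

Lemma limn_einf_ge (R : realType) (u : nat -> \bar R) (a : \bar R) :
  (forall n, (0 < n)%N -> (a <= u n)%E) -> (a <= limn_einf u)%E.
Proof.
move=> ua; rewrite limn_einf_lim; apply: lime_ge; first exact: is_cvg_einfs.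
exists 1 => // n n0; apply: le_ereal_inf_tmp => _ [k /= nk <-].
by apply: ua; exact: leq_trans nk.
Qed.

Section LowerBound.
Variables (R : realType) (d : nat) (alpha : R) (T Sigma : 'M[R]_d).
Hypotheses (halpha : 0 < alpha) (hT : spd T) (hS : spd Sigma).

(** The constant depends on the observations only through [M] and [r]: a
    cluster of linear size exists and has a bounded posterior mean, so every
    cluster with a point in the ball has a size comparable to it. *)
Lemma linear_cluster_size (M r : R) : exists2 delta : R, 0 < delta &
  forall n (x : 'I_n -> 'cV[R]_d) P J j, (0 < n)%N ->
    \sum_(i < n) enorm (x i) ^+ 2 <= M * n%:R ->
    MAP_partition alpha T Sigma x P -> J \in P -> j \in J -> enorm (x j) <= r ->
    delta * n%:R <= #|J|%:R.
Proof.
have [c [B [c1 B1 wE]]] := size_weight_bounds halpha hT hS.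
have [lam lam0 qle] := mxform_norm_bound (invmx Sigma).
have c0 : 0 < c := lt_le_trans ltr01 c1; have B0 : 0 < B := lt_le_trans ltr01 B1.
pose L := lam * M.
pose eps := (2 * c ^+ 2 * B * expR 1 * expR (L / 2))^-1.
have eps0 : 0 < eps by rewrite invr_gt0 !mulr_gt0 ?expR_gt0 ?exprn_gt0.
pose D := c ^+ 2 * expR (lam * r ^+ 2 + 4 * L / eps).
have D0 : 0 < D by rewrite mulr_gt0 ?expR_gt0 ?exprn_gt0.
exists (eps / D); first by rewrite divr_gt0.
move=> n x P J j n0 hM mapP PJ jJ xr; have n0R : 0 < n%:R :> R by rewrite ltr0n.
pose q u := mxform (invmx Sigma) u u.
have q0 u : 0 <= q u by exact/spd_ge0/spd_invmx.
have hq : \sum_(i < n) q (x i) <= L * n%:R.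
  apply: (@le_trans _ _ (lam * \sum_(i < n) enorm (x i) ^+ 2)).
    by rewrite mulr_sumr; apply: ler_sum => i _; exact: qle.
  by rewrite /L -mulrA ler_wpM2l.
have [K PK Kbig] := large_cluster hT hS c1 B1 wE n0 mapP hq.
rewrite -/eps in Kbig.
have K0R : 0 < #|K|%:R :> R by apply: lt_le_trans Kbig; rewrite mulr_gt0.
have K0 : (0 < #|K|)%N by rewrite -(ltr0n R).
have hmean : q (posterior_mean T Sigma x K) <= 4 * L / eps.
  have := posterior_mean_bound hT hS x K0; rewrite -/(q _) => hb.
  have hsum : \sum_(i in K) q (x i) <= L * n%:R.
    apply: le_trans hq; rewrite [leRHS](bigID [in K])/= lerDl sumr_ge0//.
  have L0 : 0 <= L.
    by rewrite -(pmulr_lge0 L n0R) (le_trans _ hq)// sumr_ge0.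
  rewrite ler_pdivlMr// -(ler_pM2r n0R) -mulrA.
  apply: (@le_trans _ _ (#|K|%:R * q (posterior_mean T Sigma x K))).
    by rewrite mulrC ler_wpM2r.
  by rewrite (le_trans hb)// -mulrA ler_wpM2l.
have hx : q (x j) <= lam * r ^+ 2.
  rewrite (le_trans (qle _))// ler_wpM2l// lerXn2r ?nnegrE ?sqrtr_ge0//.
  by rewrite (le_trans (sqrtr_ge0 _) xr).
have := transfer_bound hT hS c1 wE mapP PJ PK jJ; rewrite -!/(q _) => hJ.
rewrite mulrAC ler_pdivrMr// (le_trans Kbig)// (le_trans hJ)// /D.
rewrite mulrCA mulrA ler_wpM2l ?mulr_ge0 ?exprn_ge0 ?(ltW c0)// ler_expR.
exact: lerD.
Qed.
End LowerBound.

Unset Implicit Arguments.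

(* The observation x_(i+1) is [x i]: the sequence and the ground set 'I_n of
   the partitions are both indexed from 0. *)
Theorem proposition2 (R : realType) (d : nat) (hd : (1 <= d)%N)
    (alpha : R) (halpha : 0 < alpha)
    (T Sigma : 'M[R]_d) (hT : spd T) (hSigma : spd Sigma)
    (x : nat -> 'cV[R]_d)
    (hx : (ereal_sup [set (n%:R^-1 * \sum_(i < n) enorm (x i) ^+ 2)%:E
                     | n in [set n : nat | (1 <= n)%N]]%classic < +oo)%E)
    (Jhat : forall n : nat, {set {set 'I_n}})
    (hJhat : forall n : nat, (1 <= n)%N ->
       MAP_partition alpha T Sigma (fun i : 'I_n => x i) (Jhat n))
    (r : R) (hr : 0 < r) :
  (0 < limn_einf (fun n : nat =>
         min_cluster_near0 (fun i : 'I_n => x i) (Jhat n) r / (n%:R)%:E))%E.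
Proof.
set S := [set _ | _ in _]%classic in hx.
have hM n : (0 < n)%N -> \sum_(i < n) enorm (x i) ^+ 2 <= fine (ereal_sup S) * n%:R.
  move=> n0; rewrite -ler_pdivrMr ?ltr0n// mulrC -lee_fin.
  have hn : ((n%:R^-1 * \sum_(i < n) enorm (x i) ^+ 2)%:E <= ereal_sup S)%E.
    by apply: ereal_sup_ubound; exists n.
  rewrite fineK// fin_numE (lt_eqF hx) andbT gt_eqF//.
  by apply: lt_le_trans hn; exact: ltNyr.
have [delta delta0 hdelta] :=
  linear_cluster_size halpha hT hSigma (fine (ereal_sup S)) r.
apply: (@lt_le_trans _ _ delta%:E); first by rewrite lte_fin.
apply: limn_einf_ge => n n0; have n0R : 0 < n%:R :> R by rewrite ltr0n.
rewrite inver gt_eqF// lee_pdivlMr// -EFinM /min_cluster_near0.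
apply: (big_ind (fun y => ((delta * n%:R)%:E <= y)%E)) => [|y z|J].
- exact: leey.
- by rewrite le_min => -> ->.
case/andP=> PJ /existsP[j /andP[jJ /ltW xr]]; rewrite lee_fin.
exact: (hdelta n _ _ J j n0 (hM n n0) (hJhat n n0)).
Qed.
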